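(* Let $n \ge 2$, let $\boldsymbol{X}$ be a nonnegative $n$-dimensional random vector with mean vector $\boldsymbol{\mu}$ and positive definite covariance matrix $\boldsymbol{\Sigma}$, and let $G=(V,E)$ be a simple undirected graph with $V=\{1,\ldots,n\}$, with complementary edge set $\overline{E}$. The optimization problem over $\boldsymbol{A}=(a_{ij})\in\mathbb{R}^{n\times n}$ $$ \begin{cases} \text{minimize} & \frac{1}{2}\operatorname{tr}(\boldsymbol{A}\boldsymbol{\Sigma}\boldsymbol{A}^\top)\\ \text{subject to} & \boldsymbol{1}^\top\boldsymbol{A}=\boldsymbol{1}^\top,\quad \boldsymbol{A}\boldsymbol{\mu}=\boldsymbol{\mu},\quad a_{ij}=0 \text{ whenever } \{i,j\}\in\overline{E} \end{cases} $$ has a unique solution $$ \boldsymbol{A}_*=\frac{1}{n}\boldsymbol{1}\boldsymbol{1}^\top+\left(\boldsymbol{I}-\frac{1}{n}\boldsymbol{1}\boldsymbol{1}^\top\right)\left(\frac{1}{a}\boldsymbol{\mu}\boldsymbol{\mu}^\top+\boldsymbol{\Gamma}\left(\frac{1}{a}\boldsymbol{\Sigma}^{-1}\boldsymbol{\mu}\boldsymbol{\mu}^\top-\boldsymbol{I}\right)\right)\boldsymbol{\Sigma}^{-1}, $$ where $a=\boldsymbol{\mu}^\top\boldsymbol{\Sigma}^{-1}\boldsymbol{\mu}$ and $\boldsymbol{\Gamma}=(\gamma_{ij})\in\mathbb{R}^{n\times n}$ satisfies $\gamma_{ij}=0$ when $i=j$ or $\{i,j\}\in E$, and the other entries $\gamma_{ij}$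 are chosen so that the equations $$ \left(\frac{1}{n}\boldsymbol{1}\boldsymbol{1}^\top+\left(\boldsymbol{I}-\frac{1}{n}\boldsymbol{1}\boldsymbol{1}^\top\right)\left(\frac{1}{a}\boldsymbol{\mu}\boldsymbol{\mu}^\top+\boldsymbol{\Gamma}\left(\frac{1}{a}\boldsymbol{\Sigma}^{-1}\boldsymbol{\mu}\boldsymbol{\mu}^\top-\boldsymbol{I}\right)\right)\boldsymbol{\Sigma}^{-1}\right)_{ij}=0 $$ are satisfied for all $i,j$ such that $\{i,j\}\in\overline{E}$ (that is, for both ordered pairs $(i,j)$ and $(j,i)$). Such a matrix $\boldsymbol{\Gamma}$ always exists but need not be unique.
   Context: $\boldsymbol{1}$ is the $n$-dimensional column vector of ones and $\boldsymbol{I}$ the $n\times n$ identity matrix. $\boldsymbol{\mu}=\mathbb{E}[\boldsymbol{X}]$ and $\boldsymbol{\Sigma}=\mathbb{E}[(\boldsymbol{X}-\boldsymbol{\mu})(\boldsymbol{X}-\boldsymbol{\mu})^\top]$. Since $\boldsymbol{X}$ is entrywise nonnegative and $\boldsymbol{\Sigma}$ is positive definite, all entries of $\boldsymbol{\mu}$ are strictly positive. $E$ is a set of unordered pairs $\{i,j\}$ of distinct vertices, and $\overline{E}=\{\{i,j\}: i,j\in V,\ i\neq j,\ \{i,j\}\notin E\}$; in particular $\{i,i\}$ belongs to neither $E$ nor $\overline{E}$. Any $\boldsymbol{\Gamma}$ satisfying the stated conditions is meant to give, by the formula, the same matrix $\boldsymbol{A}_*$. *)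

(* Defs.v *)
From mathcomp Require Import all_boot all_order all_algebra.
From mathcomp Require Import all_classical all_reals all_analysis.
Set Implicit Arguments.
Unset Strict Implicit.
Unset Printing Implicit Defensive.
Import Order.TTheory GRing.Theory Num.Theory.
Local Open Scope ring_scope.

(* Square integrability is what makes the mean vector and the covariance
   matrix finite, so that the [fine]s below are harmless. *)
Definition nonneg_random_vector (R : realType) (d : measure_display)
    (T : measurableType d) (P : probability T R) (n : nat)
    (X : 'I_n -> {RV P >-> R}) : Prop :=
  (forall i, (X i : T -> R) \in Lfun P 2%:E) /\
  {ae P, forall w, forall i, 0 <= X i w}.

Definition mean_vector (R : realType) (d : measure_display)
    (T : measurableType d) (P : probability T R) (n : nat)
    (X : 'I_n -> {RV P >-> R}) : 'cV[R]_n :=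
  \col_i fine ('E_P[X i])%E.

Definition covariance_matrix (R : realType) (d : measure_display)
    (T : measurableType d) (P : probability T R) (n : nat)
    (X : 'I_n -> {RV P >-> R}) : 'M[R]_n :=
  \matrix_(i, j) fine (covariance P (X i) (X j)).

Definition posdef (R : realType) (n : nat) (S : 'M[R]_n) : Prop :=
  S^T = S /\ forall v : 'cV[R]_n, v != 0 -> 0 < (v^T *m S *m v) 0 0.

(* A simple undirected graph on 'I_n is given by its set of edges, each edge
   being an unordered pair of distinct vertices, i.e. a set of cardinal 2. *)
Definition simple_graph (n : nat) (E : {set {set 'I_n}}) : Prop :=
  forall e, e \in E -> #|e| = 2%N.

Definition compl_edges (n : nat) (E : {set {set 'I_n}}) : {set {set 'I_n}} :=
  [set e : {set 'I_n} | (#|e| == 2%N) && (e \notin E)].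

Definition ones (R : realType) (n : nat) : 'cV[R]_n := const_mx 1.

Definition objective (R : realType) (n : nat) (S A : 'M[R]_n) : R :=
  2^-1 * \tr (A *m S *m A^T).

Definition feasible (R : realType) (n : nat) (mu : 'cV[R]_n)
    (E : {set {set 'I_n}}) (A : 'M[R]_n) : Prop :=
  [/\ (ones R n)^T *m A = (ones R n)^T,
      A *m mu = mu &
      forall i j, [set i; j]%SET \in compl_edges E -> A i j = 0].

Definition solution (R : realType) (n : nat) (mu : 'cV[R]_n) (S : 'M[R]_n)
    (E : {set {set 'I_n}}) (A : 'M[R]_n) : Prop :=
  feasible mu E A /\
  forall B, feasible mu E B -> objective S A <= objective S B.

Definition unique_solution (R : realType) (n : nat) (mu : 'cV[R]_n)
    (S : 'M[R]_n) (E : {set {set 'I_n}}) (A : 'M[R]_n) : Prop :=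
  solution mu S E A /\ forall B, solution mu S E B -> B = A.

Definition Astar (R : realType) (n : nat) (mu : 'cV[R]_n)
    (S Gamma : 'M[R]_n) : 'M[R]_n :=
  let J := n%:R^-1 *: (ones R n *m (ones R n)^T) in
  let a := (mu^T *m invmx S *m mu) 0 0 in
  J + (1%:M - J) *m
      (a^-1 *: (mu *m mu^T)
       + Gamma *m (a^-1 *: (invmx S *m mu *m mu^T) - 1%:M)) *m invmx S.

Definition admissible_Gamma (R : realType) (n : nat) (mu : 'cV[R]_n)
    (S : 'M[R]_n) (E : {set {set 'I_n}}) (Gamma : 'M[R]_n) : Prop :=
  (forall i j, i = j \/ [set i; j]%SET \in E -> Gamma i j = 0) /\
  (forall i j, [set i; j]%SET \in compl_edges E -> Astar mu S Gamma i j = 0).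

(* Main.v *)
Require Import Defs.
From HB Require Import structures.
From mathcomp Require Import all_boot all_order all_algebra.
From mathcomp Require Import all_classical all_reals all_analysis.
From mathcomp Require Import measurable_realfun ring.
Set Implicit Arguments.
Unset Strict Implicit.
Unset Printing Implicit Defensive.
Import Order.TTheory GRing.Theory Num.Theory.
Local Open Scope ring_scope.

(** Throughout, matrices carry the Frobenius inner product
    <A, B> = tr (A B^T), J is the orthogonal projection on the line spanned by
    the vector 1 of ones, C = I - J the complementary projection, Q the inverse
    of S, a = mu^T Q mu, and K = Q - a^-1 Q mu mu^T Q.

    The candidate can be rewritten Astar G = Astar 0 - C G K.  Since 1^T C = 0
    and K mu = 0, it satisfies both linear constraints for every G.

    Optimality.  If B is feasible and A = Astar G, then D = B - A satisfies
    1^T D = 0 and D mu = 0, which annihilates every part of <A S, D> except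
    - <G, D>.  The latter vanishes because G is supported on the non-edges,
    where D is zero ([Astar_orthogonal]).  By polarization, objective B =
    objective A + tr (D S D^T) / 2, and the last term is positive unless B = A:
    this gives minimality and uniqueness at once ([Astar_unique_solution]).

    Existence of Gamma.  Let N be the restriction to non-edges, an orthogonal
    projection on matrices.  The equation for G is N (C (N G) K) = N (Astar 0).
    By the Fredholm alternative it is enough that N (Astar 0) be orthogonal to
    every V orthogonal to the range of the left-hand operator.  Put W = N V.
    Testing against the image of V itself gives <C W K, W> = 0; as C and K are
    positive semidefinite with kernels spanned by 1 and mu, this forces
    W = 1 v^T + w mu^T ([centering_reduced_kernel]).  Such a W is orthogonal to
    Astar 0 - I, by the two linear constraints, and W is orthogonal to I because
    its diagonal is zero; hence <Astar 0, W> = 0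
    ([admissible_Gamma_exists]).

    The number a is positive because mu <> 0, a consequence of nonnegativity: a
    nonnegative variable of mean zero vanishes almost surely, so it has variance
    zero, which positive definiteness forbids ([mean_vector_neq0]).

    Non-uniqueness.  C (1 v^T + w mu^T) K = 0, so such a matrix can be added to
    Gamma as soon as it vanishes on the diagonal and on the edges.  This allows
    any w that is constant on the connected components of the graph
    ([admissible_Gamma_shift]), hence a genuine change when the graph is
    disconnected.  Two isolated vertices and the indicators of the events
    Z = 0 and Z = 1, for Z binomial of parameters 2 and 1/2, give a concrete
    instance. *)

(** * The Frobenius inner product and solvability of linear equations *)

Lemma mxtrace_mul_trmx (R : comPzRingType) m n (A B : 'M[R]_(m, n)) :
  \tr (A *m B^T) = \sum_i \sum_j A i j * B i j.
Proof.
by apply: eq_bigr => i _; rewrite mxE; apply: eq_bigr => j _; rewrite mxE.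
Qed.

Lemma mxvec_mul_trmx (R : comPzRingType) m n (A B : 'M[R]_(m, n)) :
  (mxvec A *m (mxvec B)^T) 0 0 = \tr (A *m B^T).
Proof.
rewrite mxtrace_mul_trmx !mxE.
rewrite (reindex _ (curry_mxvec_bij m n)) pair_bigA /=.
by apply: eq_bigr => -[k l] _ /=; rewrite mxE !mxvecE.
Qed.

(** Row spaces are the annihilators of their cokernels: the columns of the
    cokernel of the matrix of f, reshaped, are the matrices V orthogonal to the
    range. *)
Lemma fredholm_alternative (F : fieldType) m n
    (f : {linear 'M[F]_(m, n) -> 'M[F]_(m, n)}) (B : 'M[F]_(m, n)) :
  (forall V, (forall G, \tr (f G *m V^T) = 0) -> \tr (B *m V^T) = 0) ->
  exists G, f G = B.
Proof.
move=> fB; have: (mxvec B <= lin_mx f)%MS.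
  rewrite submxE; apply/eqP/matrixP => i j; rewrite ord1 [RHS]mxE.
  pose V := vec_mx (col j (cokermx (lin_mx f)))^T.
  have VE G : \tr (G *m V^T) = (mxvec G *m cokermx (lin_mx f)) 0 j.
    rewrite -mxvec_mul_trmx /V vec_mxK trmxK.
    rewrite [LHS]mxE [RHS]mxE; apply: eq_bigr => k _.
    by rewrite [col _ _ _ _]mxE.
  rewrite -VE; apply: fB => G; rewrite VE -mul_vec_lin -mulmxA mulmx_coker.
  by rewrite mulmx0 mxE.
case/submxP => D BD; exists (vec_mx D); apply: (can_inj mxvecK).
by rewrite -mul_vec_lin vec_mxK BD.
Qed.

(** * Positive definite matrices and the objective *)

Lemma posdef_unitmx (R : realType) n (S : 'M[R]_n) : posdef S -> S \in unitmx.
Proof.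
case=> _ Spos; rewrite -row_free_unit -kermx_eq0; apply/eqP/row_matrixP => i.
rewrite row0; apply/eqP; apply: contraT => v0.
have /Spos : (row i (kermx S))^T != 0 by rewrite trmx_eq0.
by rewrite trmxK -row_mul mulmx_ker row0 mul0mx mxE ltxx.
Qed.

Lemma posdef_ge0 (R : realType) n (S : 'M[R]_n) (v : 'rV_n) : posdef S ->
  0 <= (v *m S *m v^T) 0 0 ?= iff (v == 0).
Proof.
move=> [_ Spos]; apply/leifP; case: eqP => [->|/eqP v0].
  by rewrite mul0mx mul0mx mxE.
by rewrite -{1}[v]trmxK Spos // trmx_eq0.
Qed.

Lemma posdef_mxtrace_ge0 (R : realType) m n (S : 'M[R]_n) (D : 'M[R]_(m, n)) :
  posdef S -> 0 <= \tr (D *m S *m D^T) ?= iff (D == 0).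
Proof.
move=> Spos.
have DE i : (D *m S *m D^T) i i = (row i D *m S *m (row i D)^T) 0 0.
  rewrite tr_row -row_mul [RHS]mxE [LHS]mxE.
  by apply: eq_bigr => k _; rewrite !mxE.
rewrite /mxtrace (eq_bigr _ (fun i _ => DE i)).
have <- : [forall (i | true), row i D == 0] = (D == 0).
  apply/forallP/eqP => [D0|-> i]; last by rewrite row0 eqxx.
  by apply/row_matrixP => i; rewrite row0; apply/eqP/D0.
have := leif_sum (fun i (_ : true) => posdef_ge0 (row i D) Spos).
by rewrite big1_eq.
Qed.

(** Polarization: the two cross terms coincide because S is symmetric. *)
Lemma objectiveD (R : realType) n (S A D : 'M[R]_n) :
  S^T = S -> \tr (A *m S *m D^T) = 0 ->
  objective S (A + D) = objective S A + 2^-1 * \tr (D *m S *m D^T).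
Proof.
move=> Ssym cross.
have cross' : \tr (D *m S *m A^T) = 0.
  by rewrite -mxtrace_tr !trmx_mul trmxK mulmxA Ssym.
rewrite /objective -mulrDr; congr (_ * _).
rewrite [_^T]linearD /= mulmxDl mulmxDl !mulmxDr !linearD /=.
by rewrite cross cross' addr0 add0r.
Qed.

(** * The deterministic problem *)

Section algebra.
Variables (R : realType) (n : nat) (mu : 'cV[R]_n) (S : 'M[R]_n).
Hypotheses (n_gt0 : (0 < n)%N) (mu_neq0 : mu != 0) (Spos : posdef S).

Local Notation u := (ones R n).
Local Notation Q := (invmx S).
Let a : R := (mu^T *m Q *m mu) 0 0.

Definition averaging : 'M[R]_n := n%:R^-1 *: (u *m u^T).
Definition centering : 'M[R]_n := 1%:M - averaging.

(** The precision matrix with the direction mu projected out: it is positive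
    semidefinite with kernel spanned by mu, and its product with S is the
    projection on the hyperplane mu^T x = 0 along Q mu. *)
Definition reduced_precision : 'M[R]_n := Q - a^-1 *: (Q *m mu *m mu^T *m Q).

Local Notation J := averaging.
Local Notation C := centering.
Local Notation K := reduced_precision.

Lemma mul_ones_ones : u^T *m u = n%:R%:M.
Proof.
apply/matrixP => i j; rewrite !ord1 !mxE eqxx mulr1n.
under eq_bigr do rewrite !mxE mulr1.
by rewrite sumr_const card_ord.
Qed.

Lemma n_neq0 : n%:R != 0 :> R. Proof. by rewrite pnatr_eq0 -lt0n. Qed.

Lemma averaging_sym : J^T = J.
Proof. by rewrite /averaging linearZ /= trmx_mul trmxK. Qed.

Lemma averaging_ones : J *m u = u.
Proof.
by rewrite /J -scalemxAl -mulmxA mul_ones_ones mul_mx_scalar scalerA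
  mulVf ?n_neq0 // scale1r.
Qed.

Lemma centering_sym : C^T = C.
Proof. by rewrite /C linearB /= trmx1 averaging_sym. Qed.

Lemma centering_ones : C *m u = 0.
Proof. by rewrite /C mulmxBl mul1mx averaging_ones subrr. Qed.

Lemma ones_centering : u^T *m C = 0.
Proof. by rewrite -centering_sym -trmx_mul centering_ones trmx0. Qed.

Lemma centering_averaging : C *m J = 0.
Proof.
by rewrite /averaging -scalemxAr mulmxA centering_ones mul0mx scaler0.
Qed.

Lemma centering_idem : C *m C = C.
Proof. by rewrite {2}/centering mulmxBr mulmx1 centering_averaging subr0. Qed.

Lemma S_unit : S \in unitmx. Proof. exact: posdef_unitmx. Qed.

Lemma invmx_sym : Q^T = Q.
Proof. by rewrite trmx_inv; case: Spos => ->. Qed.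

Lemma quad_gt0 : 0 < a.
Proof.
have Qmu0 : Q *m mu != 0.
  apply: contraNneq mu_neq0 => Qmu0.
  by rewrite -[mu](mulKVmx S_unit) Qmu0 mulmx0.
have [_ /(_ _ Qmu0)] := Spos.
by rewrite trmx_mul invmx_sym mulmxKV ?S_unit // mulmxA.
Qed.

Lemma quadE : mu^T *m Q *m mu = a%:M.
Proof. by apply/matrixP => i j; rewrite !ord1 [RHS]mxE eqxx mulr1n. Qed.

Lemma quad_neq0 : a != 0. Proof. by rewrite gt_eqF ?quad_gt0. Qed.

Lemma reduced_precision_mu : K *m mu = 0.
Proof.
rewrite /reduced_precision mulmxBl -scalemxAl -2!(mulmxA (Q *m mu)) quadE.
by rewrite mul_mx_scalar scalerA mulVf ?quad_neq0 // scale1r subrr.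
Qed.

Lemma reduced_precision_sym : K^T = K.
Proof.
rewrite /K linearB linearZ /= !trmx_mul trmxK invmx_sym.
by rewrite !mulmxA.
Qed.

Lemma mu_reduced_precision : mu^T *m K = 0.
Proof.
by rewrite -reduced_precision_sym -trmx_mul reduced_precision_mu trmx0.
Qed.

Lemma reduced_precisionS :
  K *m S = 1%:M - a^-1 *: (Q *m mu *m mu^T).
Proof. by rewrite /K mulmxBl -scalemxAl mulmxKV ?S_unit // mulVmx ?S_unit. Qed.

(** This factorization reduces statements on the degenerate form K to the
    definiteness of S. *)
Lemma reduced_precision_KSK : K *m S *m K = K.
Proof.
rewrite reduced_precisionS mulmxBl mul1mx -scalemxAl -(mulmxA (Q *m mu)).
by rewrite mu_reduced_precision mulmx0 scaler0 subr0.
Qed.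

Definition Astar0 : 'M[R]_n := J + a^-1 *: (C *m mu *m mu^T *m Q).

Lemma AstarE G : Astar mu S G = Astar0 - C *m G *m K.
Proof.
rewrite /Astar -/J -/C -/a /Astar0 -addrA; congr (_ + _).
rewrite mulmxDr mulmxDl -scalemxAr -scalemxAl !mulmxA; congr (_ + _).
rewrite -mulmxA -mulmxN; congr (_ *m _).
by rewrite mulmxBl mul1mx opprB -scalemxAl.
Qed.

Lemma ones_Astar G : u^T *m Astar mu S G = u^T.
Proof.
rewrite AstarE /Astar0 mulmxBr mulmxDr -(scalemxAr a^-1) !mulmxA ones_centering.
rewrite !mul0mx scaler0 addr0 subr0.
by rewrite -averaging_sym -trmx_mul averaging_ones.
Qed.

Lemma Astar_mu G : Astar mu S G *m mu = mu.
Proof.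
rewrite AstarE /Astar0 mulmxBl mulmxDl -[_ *m K *m mu]mulmxA.
rewrite reduced_precision_mu mulmx0 subr0 -(scalemxAl a^-1).
rewrite -2!(mulmxA (C *m mu)) quadE mul_mx_scalar scalerA mulVf ?quad_neq0 // scale1r.
by rewrite -mulmxDl addrC subrK mul1mx.
Qed.

(** The gradient of the objective at Astar G pairs with feasible directions as
    - G does, so G is the matrix of Lagrange multipliers of the sparsity
    constraints. *)
Lemma Astar_orthogonal G (D : 'M[R]_n) :
  u^T *m D = 0 -> D *m mu = 0 ->
  \tr (Astar mu S G *m S *m D^T) = - \tr (G *m D^T).
Proof.
move=> uD Dmu.
have Du : D^T *m u = 0 by rewrite -[u]trmxK -trmx_mul uD trmx0.
have muD : mu^T *m D^T = 0 by rewrite -trmx_mul Dmu trmx0.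
have DC : D^T *m C = D^T.
  by rewrite /C mulmxBr mulmx1 /J -scalemxAr mulmxA Du mul0mx scaler0 subr0.
have KSD : K *m S *m D^T = D^T.
  rewrite reduced_precisionS mulmxBl mul1mx -scalemxAl -(mulmxA (Q *m mu)) muD.
  by rewrite mulmx0 scaler0 subr0.
have CGKSD : C *m G *m K *m S *m D^T = C *m G *m D^T.
  by rewrite -2!(mulmxA (C *m G)) KSD.
have muQSD : C *m mu *m mu^T *m Q *m S *m D^T = 0.
  by rewrite mulmxKV ?S_unit // -(mulmxA (C *m mu)) muD mulmx0.
have -> : Astar mu S G *m S *m D^T = J *m S *m D^T - C *m G *m D^T.
  rewrite AstarE /Astar0 2!mulmxBl 2!mulmxDl -2!(scalemxAl a^-1) muQSD.
  by rewrite scaler0 addr0 CGKSD.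
rewrite linearB /= -[C *m G *m _]mulmxA [\tr (C *m _)]mxtrace_mulC.
rewrite -(mulmxA G) DC.
rewrite /J -!scalemxAl linearZ /= -!mulmxA mxtrace_mulC -!mulmxA Du.
by rewrite !mulmx0 mxtrace0 mulr0 sub0r.
Qed.

(** Feasible directions vanish on the non-edges and G vanishes elsewhere, so the
    objective at any feasible B exceeds that at Astar G by half the quadratic
    form of S at B - Astar G. *)
Lemma Astar_unique_solution E G : admissible_Gamma mu S E G ->
  unique_solution mu S E (Astar mu S G).
Proof.
move=> [G0 AG0].
set A := Astar mu S G.
have feasA : feasible mu E A by split=> //; [exact: ones_Astar|exact: Astar_mu].
have gap B : feasible mu E B -> objective S A <= objective S B ?= iff (B == A).
  move=> [uB Bmu B0]; pose D := B - A.
  have uD : u^T *m D = 0 by rewrite mulmxBr uB ones_Astar subrr.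
  have Dmu : D *m mu = 0 by rewrite mulmxBl Bmu Astar_mu subrr.
  have cross : \tr (A *m S *m D^T) = 0.
    rewrite Astar_orthogonal // mxtrace_mul_trmx big1 ?oppr0 // => i _.
    rewrite big1 // => j _.
    have [ij|ij] := eqVneq i j; first by rewrite G0 ?mul0r //; left.
    have [ijE|ijE] := boolP ([set i; j]%SET \in E).
      by rewrite G0 ?mul0r //; right.
    have ijC : [set i; j]%SET \in compl_edges E by rewrite inE cards2 ij.
    suff -> : D i j = 0 by rewrite mulr0.
    by rewrite mxE [(- A) i j]mxE (AG0 _ _ ijC) (B0 _ _ ijC) subrr.
  have -> : objective S B = objective S A + 2^-1 * \tr (D *m S *m D^T).
    by rewrite -(objectiveD (proj1 Spos) cross) addrC subrK.
  have := posdef_mxtrace_ge0 D Spos.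
  rewrite subr_eq0 => /leifP; case: (B == A) => [/eqP <-|DSD].
    by apply/leifP; rewrite mulr0 addr0.
  by apply/leifP; rewrite ltrDl mulr_gt0 // invr_gt0.
split=> [|B [feasB optB]].
  by split=> // B /gap [].
have [le_AB eq_AB] := gap B feasB.
apply/eqP; rewrite -eq_AB eq_le le_AB /=.
exact: optB.
Qed.

(** With Y = C W, idempotency of C and K S K = K turn the hypothesis into
    tr ((Y K) S (Y K)^T) = 0, so Y K = 0.  Multiplying by S shows that the rows
    of Y are proportional to mu^T, and W - Y = J W has equal rows. *)
Lemma centering_reduced_kernel (W : 'M[R]_n) :
  \tr (C *m W *m K *m W^T) = 0 ->
  exists v w : 'cV[R]_n, W = u *m v^T + w *m mu^T.
Proof.
pose Y := C *m W => trW.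
have trY : \tr ((Y *m K) *m S *m (Y *m K)^T) = 0.
  rewrite trmx_mul reduced_precision_sym mulmxA -[Y *m K *m S *m K]mulmxA.
  rewrite -[Y *m K *m _]mulmxA (mulmxA K) reduced_precision_KSK.
  rewrite /Y trmx_mul centering_sym mulmxA mxtrace_mulC !mulmxA.
  by rewrite centering_idem.
have YK0 : Y *m K = 0.
  by apply/eqP; rewrite -(posdef_mxtrace_ge0 (Y *m K) Spos).2 trY.
have YE : Y = (a^-1 *: (Y *m Q *m mu)) *m mu^T.
  have := congr1 (mulmx^~ S) YK0; rewrite mul0mx -mulmxA reduced_precisionS.
  rewrite mulmxBr mulmx1 -scalemxAr => /subr0_eq {1}->.
  by rewrite -scalemxAl !mulmxA.
exists (n%:R^-1 *: (W^T *m u)), (a^-1 *: (Y *m Q *m mu)).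
rewrite -YE /Y /C mulmxBl mul1mx addrC.
suff -> : u *m (n%:R^-1 *: (W^T *m u))^T = J *m W by rewrite subrK.
by rewrite linearZ /= trmx_mul trmxK -scalemxAr mulmxA scalemxAl.
Qed.

Definition nonedge_part (E : {set {set 'I_n}}) (A : 'M[R]_n) : 'M[R]_n :=
  \matrix_(i, j) if [set i; j]%SET \in compl_edges E then A i j else 0.

Lemma nonedge_part_linear E : linear (nonedge_part E).
Proof.
move=> c A B; apply/matrixP => i j; rewrite !mxE.
by case: ifP; rewrite ?mulr0 ?addr0.
Qed.

Lemma nonedge_part_adjoint E A B :
  \tr (nonedge_part E A *m B^T) = \tr (A *m (nonedge_part E B)^T).
Proof.
rewrite !mxtrace_mul_trmx; apply: eq_bigr => i _; apply: eq_bigr => j _.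
by rewrite !mxE; case: ifP; rewrite ?mulr0 ?mul0r.
Qed.

Lemma nonedge_part_eq0 (E : {set {set 'I_n}}) A (i j : 'I_n) :
  i = j \/ [set i; j]%SET \in E -> nonedge_part E A i j = 0.
Proof.
rewrite mxE inE cards2 => -[->|->]; first by rewrite eqxx.
by rewrite andbF.
Qed.

(** The Fredholm alternative for G |-> N (C (N G) K): a matrix V orthogonal to
    the range is in particular orthogonal to its own image. *)
Lemma admissible_Gamma_exists E : exists G, admissible_Gamma mu S E G.
Proof.
pose N := nonedge_part E.
pose f W := N (C *m N W *m K).
have lf : linear f.
  move=> c A B; rewrite /f /N nonedge_part_linear (mulmxDr C) (mulmxDl _ _ K).
  by rewrite -(scalemxAr c) -(scalemxAl c) nonedge_part_linear.
pose F : {linear 'M[R]_n -> 'M[R]_n} :=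
  HB.pack f (GRing.isLinear.Build _ _ _ _ f lf).
have [V fV|G FG] := @fredholm_alternative _ _ _ F (N Astar0).
  have trW : \tr (C *m N V *m K *m (N V)^T) = 0.
    by rewrite -nonedge_part_adjoint; exact: (fV V).
  have [v [w VE]] := centering_reduced_kernel trW.
  have A0E : Astar0 = Astar mu S 0 by rewrite AstarE mulmx0 mul0mx subr0.
  have tr1 : \tr (1%:M *m (N V)^T) = 0.
    rewrite mul1mx mxtrace_tr /mxtrace big1 // => i _.
    by rewrite nonedge_part_eq0 //; left.
  (* N V has zero diagonal, so Astar0 may be replaced by Astar0 - I, which both
     linear constraints annihilate. *)
  pose B := Astar0 - 1%:M.
  have uB : u^T *m B = 0 by rewrite mulmxBr A0E ones_Astar mulmx1 subrr.
  have Bmu : B *m mu = 0 by rewrite mulmxBl A0E Astar_mu mul1mx subrr.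
  have -> : \tr (N Astar0 *m V^T) = \tr (B *m (N V)^T).
    by rewrite nonedge_part_adjoint mulmxBl [RHS]linearB /= tr1 subr0.
  rewrite VE [_^T]linearD /= !trmx_mul !trmxK mulmxDr [LHS]linearD /=.
  rewrite mulmxA mxtrace_mulC mulmxA uB mul0mx mxtrace0 add0r.
  by rewrite mulmxA Bmu mul0mx mxtrace0.
exists (N G); split=> [i j|i j ij]; first exact: nonedge_part_eq0.
have : (N (C *m N G *m K)) i j = N Astar0 i j by rewrite -FG.
rewrite [LHS]mxE [RHS]mxE ij AstarE => FGij.
by rewrite mxE [X in _ + X]mxE FGij subrr.
Qed.

Lemma Astar_shift G (v w : 'cV[R]_n) :
  Astar mu S (G + u *m v^T + w *m mu^T) = Astar mu S G.
Proof.
rewrite !AstarE; congr (_ - _).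
rewrite 2!(mulmxDr C) 2!(mulmxDl _ _ K) !(mulmxA C) centering_ones.
rewrite 2!mul0mx addr0 -(mulmxA (C *m w)) mu_reduced_precision.
by rewrite mulmx0 addr0.
Qed.

(** The added matrix has entries (w i - w j) mu_j: it vanishes on the diagonal
    and on the edges because w is constant on connected components. *)
Lemma admissible_Gamma_shift (E : {set {set 'I_n}}) G (w : 'cV[R]_n) :
  (forall i j : 'I_n, [set i; j]%SET \in E -> w i 0 = w j 0) ->
  admissible_Gamma mu S E G ->
  admissible_Gamma mu S E
    (G + u *m (\col_j (- (w j 0 * mu j 0)))^T + w *m mu^T).
Proof.
move=> wE [G0 AG0]; split=> [i j ij|i j ij]; last by rewrite Astar_shift AG0.
have wij : w i 0 = w j 0 by case: ij => [->|/wE].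
rewrite !mxE G0 // !big_ord1 !mxE wij.
by rewrite mul1r add0r addNr.
Qed.

End algebra.

(** * Positivity of the mean *)

Lemma ae_nonneg_expectation0 (R : realType) d (T : measurableType d)
    (P : probability T R) (X : {RV P >-> R}) :
  (\forall w \ae P, 0 <= X w) -> ('E_P[X] = 0)%E ->
  (\forall w \ae P, X w = 0).
Proof.
move=> X_ge0; rewrite unlock => EX0.
have mX : measurable_fun [set: _]%classic (EFin \o X) by exact/measurable_EFinP.
have : (\int[P]_w `|(X w)%:E| = 0)%E.
  rewrite -[RHS]EX0; apply: ae_eq_integral => //; first exact: measurableT_comp.
  by apply: filterS X_ge0 => w Xw _; rewrite gee0_abs // lee_fin.
move/(ae_eq_integral_abs P measurableT mX); apply: filterS => w Xw0.
by have [] := Xw0 Logic.I.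
Qed.

Lemma ae0_covariance0 (R : realType) d (T : measurableType d)
    (P : probability T R) (X : {RV P >-> R}) :
  ('E_P[X] = 0)%E -> (\forall w \ae P, X w = 0) -> covariance P X X = 0%E.
Proof.
move=> EX0 X0; rewrite unlock EX0 /= unlock.
rewrite -[RHS](@integral0 _ _ _ P [set: T]%classic).
apply: ae_eq_integral => //.
  apply/measurable_EFinP; apply: measurable_funM; exact: measurable_funB.
apply: filterS X0 => w Xw0 _.
by change (((X w - 0) * (X w - 0))%:E = 0%E); rewrite Xw0 subr0 mulr0.
Qed.

(** A zero mean would make X i vanish almost surely, hence the quadratic form
    of the covariance matrix vanish at the i-th basis vector. *)
Lemma mean_vector_neq0 (R : realType) d (T : measurableType d)
    (P : probability T R) n (X : 'I_n -> {RV P >-> R}) i :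
  nonneg_random_vector X -> posdef (covariance_matrix X) ->
  mean_vector X i 0 != 0.
Proof.
move=> [X2 X_ge0] [_ Spos]; apply/eqP; rewrite mxE => mu0.
have EX0 : ('E_P[X i] = 0)%E.
  rewrite -[LHS]fineK ?mu0 // expectation_fin_num //.
  by apply: Lfun_subset12; [exact: fin_num_measure|exact: X2].
have Xi_ge0 : \forall w \ae P, 0 <= X i w by apply: filterS X_ge0 => w; apply.
have cov0 := ae0_covariance0 EX0 (ae_nonneg_expectation0 Xi_ge0 EX0).
have /Spos : delta_mx i 0 != 0 :> 'cV[R]_n.
  by apply/eqP => /matrixP /(_ i 0) /eqP; rewrite !mxE !eqxx oner_eq0.
by rewrite trmx_delta -rowE -colE !mxE cov0 ltxx.
Qed.

(** * A random vector with several admissible multipliers *)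

Section example.
Variable R : realType.

Definition binomial2 : probability nat R := binomial_prob 2 (2^-1 : R).

Lemma measurable_nat_fun (f : nat -> R) : measurable_fun [set: _]%classic f.
Proof. by []. Qed.

(** The values 0, 1, 2 of a binomial variable give affinely independent
    points (1, 0), (0, 1), (0, 0), hence a nondegenerate covariance. *)
Definition hit (i : nat) : nat -> R := fun w => (w == i)%:R.

HB.instance Definition _ (i : nat) :=
  @isMeasurableFun.Build _ _ nat R (hit i) (@measurable_nat_fun _).

Definition hit_rv (i : 'I_2) : {RV binomial2 >-> R} := hit i.

Definition binomial2_mean (f : nat -> R) : R :=
  4^-1 * f 0 + 2^-1 * f 1 + 4^-1 * f 2.

Lemma integral_binomial2 (f : nat -> R) : (forall x, 0 <= f x) ->
  (\int[binomial2]_x (f x)%:E = (binomial2_mean f)%:E)%E.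
Proof.
move=> f0.
have p0 : 0 <= 2^-1 :> R by rewrite invr_ge0.
have p1 : 2^-1 <= 1 :> R by rewrite invf_le1 // ler1n.
rewrite (@integral_binomial R 2 2^-1 p0 p1 (EFin \o f)) /=; last first.
  by move=> x; rewrite lee_fin.
rewrite !big_ord_recl big_ord0 /= addr0 /bump /= -!EFinM -!EFinD.
congr EFin; rewrite /binomial2_mean /unstable.onem bin0 bin1 binn.
by field.
Qed.

Lemma Lfun_binomial2 (f : nat -> R) (r : R) : f \in Lfun binomial2 r%:E.
Proof.
rewrite inE; apply/andP; split; first by rewrite inE.
by rewrite inE /= /finite_norm unlock poweR_lty // integral_binomial2 ?ltry //.
Qed.

Lemma expectation_binomial2 (f : nat -> R) : (forall x, 0 <= f x) ->
  ('E_binomial2[f] = (binomial2_mean f)%:E)%E.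
Proof. by move=> f0; rewrite unlock integral_binomial2. Qed.

Lemma covariance_binomial2 (f g : nat -> R) :
  (forall x, 0 <= f x) -> (forall x, 0 <= g x) ->
  covariance binomial2 f g
    = (binomial2_mean (fun x => f x * g x)
       - binomial2_mean f * binomial2_mean g)%:E.
Proof.
move=> f0 g0; rewrite covarianceE ?Lfun_binomial2 //.
rewrite !expectation_binomial2 //.
by move=> x; exact: mulr_ge0.
Qed.

Lemma hit_ge0 i x : 0 <= hit i x. Proof. exact: ler0n. Qed.

Lemma nonneg_hit : nonneg_random_vector hit_rv.
Proof.
split=> [i|]; first exact: Lfun_binomial2.
by apply: aeW => x i; exact: hit_ge0.
Qed.

Lemma covariance_hit : covariance_matrix hit_rv
  = \matrix_(i, j) (binomial2_mean (fun x => hit i x * hit j x)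
                    - binomial2_mean (hit i) * binomial2_mean (hit j)).
Proof.
apply/matrixP => i j; rewrite !mxE covariance_binomial2 //; exact: hit_ge0.
Qed.

Lemma posdef_hit : posdef (covariance_matrix hit_rv).
Proof.
rewrite covariance_hit; split=> [|v v0].
  apply/matrixP => i j; rewrite !mxE [X in _ - X]mulrC /binomial2_mean.
  by congr (_ * _ + _ * _ + _ * _ - _); rewrite mulrC.
pose x : R := v 0 0; pose y : R := v 1 0.
have -> : forall M : 'M[R]_2, (v^T *m M *m v) 0 0
   = x ^+ 2 * M 0 0 + x * y * (M 0 1 + M 1 0) + y ^+ 2 * M 1 1.
  move=> M; rewrite !mxE !big_ord_recl big_ord0 !mxE !big_ord_recl !big_ord0.
  rewrite !mxE /=.
  have -> : lift ord0 ord0 = 1 :> 'I_2 by exact/val_inj.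
  by rewrite -/x -/y; ring.
rewrite !mxE /binomial2_mean /hit /=.
set q := (q in 0 < q).
(* Completing the square in y. *)
have -> : q = 4^-1 * (y - 2^-1 * x) ^+ 2 + 8^-1 * x ^+ 2.
  by rewrite /q; field.
have [x0|x0] := eqVneq x 0; last first.
  apply: ltr_wpDl; first by rewrite mulr_ge0 ?invr_ge0 ?ler0n ?sqr_ge0.
  by rewrite mulr_gt0 ?invr_gt0 ?ltr0n // exprn_even_gt0.
have y0 : y != 0.
  apply: contra_neq v0 => y0; apply/matrixP => i j; rewrite ord1 mxE.
  case: i => -[|[|//]] Hi; first by rewrite -x0; congr (v _ _); apply/val_inj.
  by rewrite -y0; congr (v _ _); apply/val_inj.
rewrite x0 !mulr0 subr0 expr0n mulr0 addr0.
by rewrite mulr_gt0 ?invr_gt0 ?ltr0n // exprn_even_gt0.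
Qed.

End example.

(** * The optimization theorem *)

Theorem theorem2p1 (R : realType) :
  (forall (n : nat) (d : measure_display) (T : measurableType d)
      (P : probability T R) (X : 'I_n -> {RV P >-> R})
      (E : {set {set 'I_n}}),
    (2 <= n)%N ->
    nonneg_random_vector X ->
    posdef (covariance_matrix X) ->
    simple_graph E ->
    (exists Gamma : 'M[R]_n,
      admissible_Gamma (mean_vector X) (covariance_matrix X) E Gamma) /\
    (forall Gamma : 'M[R]_n,
      admissible_Gamma (mean_vector X) (covariance_matrix X) E Gamma ->
      unique_solution (mean_vector X) (covariance_matrix X) E
        (Astar (mean_vector X) (covariance_matrix X) Gamma))) /\
  (exists (n : nat) (d : measure_display) (T : measurableType d)
      (P : probability T R) (X : 'I_n -> {RV P >-> R})
      (E : {set {set 'I_n}}),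
    (2 <= n)%N /\
    nonneg_random_vector X /\
    posdef (covariance_matrix X) /\
    simple_graph E /\
    exists Gamma1 Gamma2 : 'M[R]_n,
      Gamma1 <> Gamma2 /\
      admissible_Gamma (mean_vector X) (covariance_matrix X) E Gamma1 /\
      admissible_Gamma (mean_vector X) (covariance_matrix X) E Gamma2).
Proof.
split=> [n d T P X E n_ge2 X_ge0 Spos _|].
  have n_gt0 : (0 < n)%N by exact: ltnW.
  have mu0 : mean_vector X != 0.
    apply: contra_neq (mean_vector_neq0 (Ordinal n_gt0) X_ge0 Spos) => ->.
    by rewrite mxE.
  split=> [|G admG]; first exact: admissible_Gamma_exists.
  exact: Astar_unique_solution.
(* With no edge, w is unconstrained; taking it nonconstant changes the entry
   (0, 1) of Gamma by mu_1. *)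
pose X := @hit_rv R; pose E : {set {set 'I_2}} := finset.set0.
have X_ge0 := nonneg_hit R; have Spos := posdef_hit R.
have mu1 : mean_vector X 1 0 != 0 by exact: mean_vector_neq0.
have mu0 : mean_vector X != 0.
  by apply: contra_neq mu1 => ->; rewrite mxE.
have [G admG] := admissible_Gamma_exists (isT : 0 < 2)%N mu0 Spos E.
pose w : 'cV[R]_2 := delta_mx 0 0.
have admG' : admissible_Gamma (mean_vector X) (covariance_matrix X) E _ :=
  admissible_Gamma_shift (isT : 0 < 2)%N mu0 Spos (w := w)
    (fun i j ijE => match negP (negbT (finset.in_set0 _)) ijE with end) admG.
exists 2%N, _, nat, (binomial2 R), X, E; split=> //; split=> //; split=> //.
split; first by move=> e; rewrite finset.in_set0.
exists G; eexists; split; last by split; [exact: admG|exact: admG'].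
rewrite -addrA => /eqP; rewrite -subr_eq0 opprD addrA subrr add0r oppr_eq0.
move=> /eqP /matrixP /(_ 0 1); move: mu1; clear.
move: (mean_vector X) => m m1.
rewrite !mxE !big_ord1 !mxE /= mul1r mul0r oppr0 add0r mul1r.
by apply/eqP.
Qed.
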